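(* Let $F(x,\alpha,\beta)=x+\alpha+\beta\sin(2\pi x)$. Let $p,q$ be coprime integers with $0\le p<q$, and consider a $C^1$ path $\mu\mapsto(\alpha(\mu),\beta(\mu))\in\mathbb{R}^2$, defined for $\mu$ in a neighbourhood of $0$, with $(\alpha(0),\beta(0))=(\frac{p}{q},0)$. Let $\rho(\mu)$ be the rotation number of the lift $x\mapsto F(x,\alpha(\mu),\beta(\mu))$. (1) If $0<|\alpha'(0)|<\infty$, then $\rho(\mu)$ is differentiable at $\mu=0$, and if $q\ge 2$ then $\rho'(0)=\alpha'(0)$. (2) If $(\alpha(0),\beta(0))=(0,0)$ and $|\alpha'(0)|>|\beta'(0)|$, then $\rho(\mu)$ is differentiable at $\mu=0$ with $$\rho'(0)=\mathrm{sign}(\alpha'(0))\sqrt{|\alpha'(0)|^2-|\beta'(0)|^2}.$$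
   Context: A lift of an orientation preserving circle homeomorphism is a continuous increasing function $F:\mathbb{R}\to\mathbb{R}$ with $F(x+1)=F(x)+1$. Its rotation number is $\rho(F)=\lim_{n\to\infty}\frac1n(F^n(x)-x)$, where $F^n$ is the $n$-fold composition; the limit exists and does not depend on $x$. The map $x\mapsto x+\alpha+\beta\sin(2\pi x)$ (the lift of the Arnold circle map) is the lift of an orientation preserving circle homeomorphism when $|\beta|<\frac{1}{2\pi}$, so $\rho(\mu)$ is defined for $\mu$ near $0$. Primes denote derivatives with respect to $\mu$. *)

(* Defs.v *)
From Stdlib Require Import Reals ZArith Znumtheory.
From Coquelicot Require Import Coquelicot.
Open Scope R_scope.

Definition arnold (x alpha beta : R) : R :=
  x + alpha + beta * sin (2 * PI * x).

Definition is_rotation_number (F : R -> R) (r : R) : Prop :=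
  forall x : R,
    is_lim_seq (fun n : nat => (Nat.iter n F x - x) / INR n) (Finite r).

(* [iota] is Coquelicot's description operator: the value is the unique [r]
   with [is_rotation_number F r], and is meaningless if there is none (there is
   one whenever [F] lifts an orientation preserving circle homeomorphism). *)
Definition rotation_number (F : R -> R) : R := iota (is_rotation_number F).

Definition C1_near (f : R -> R) (x : R) : Prop :=
  locally x (fun t : R => ex_derive f t /\ continuous (Derive f) t).

(* Main.v *)
Require Import Defs.
From Stdlib Require Import Reals ZArith Znumtheory.
From Coquelicot Require Import Coquelicot.
From Stdlib Require Import Lra Lia.
Open Scope R_scope.

(** The rotation number is the mean speed of an orbit, and a mean speed can be
    measured in any coordinate [h] at bounded distance from the identity.  So if
    every step of [F] advances [h] by at most (at least) [d], then the rotation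
    number is at most (at least) [d]: [rotation_number_le],
    [rotation_number_ge].  The theorem follows by choosing, near each base point
    [(p/q, 0)], a coordinate in which the map almost is a translation.

    If [q >= 2], the rotation by [p/q] averages the sine out.  The coordinate
    [x + beta * cos (2 PI x - PI alpha) / (2 sin (PI alpha))] absorbs the term
    [beta * sin (2 PI x)] exactly to first order, and what remains is quadratic
    in [beta]; hence [rho - alpha = O(beta ^ 2)]
    ([rotation_number_nonresonant]) and [rho] has the derivative of [alpha].

    If [q = 1], the map with parameters about [(mu a, mu b)] is nearly the time
    [mu] map of the flow [x' = a + b sin (2 PI x)].  When [|b| < |a|] this flow
    has no rest point, and the integral of a Poisson kernel is a coordinate that
    straightens it to constant speed [sign a * sqrt (a ^ 2 - b ^ 2)]
    ([straightening_coordinate]); a second-order Taylor estimate gives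
    [rho mu = mu * sign a * sqrt (a ^ 2 - b ^ 2) + o(mu)].  When [|a| <= |b|] the
    map is squeezed between those of the two flows with [a] replaced by [A] and
    [- A], for [A] slightly larger than [|b|].  Their speeds tend to [0] as [A]
    decreases to [|b|], so [rho] has derivative [0], which is also the value of
    the formula since [sqrt] vanishes on negative numbers.  Thus a single formula
    covers all resonant paths ([is_derive_rotation_resonant]). *)

(** * Lifts of circle maps and existence of the rotation number *)

Definition is_lift (F : R -> R) : Prop :=
  (forall x y : R, x <= y -> F x <= F y) /\
  (forall x : R, F (x + 1) = F x + 1).

Lemma is_lift_iter (F : R -> R) (n : nat) :
  is_lift F -> is_lift (Nat.iter n F).
Proof.
  intros [Fmono Fshift]; split.
  - intros x y xy; induction n as [|n IH]; simpl; auto.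
  - intros x; induction n as [|n IH]; simpl; [reflexivity|].
    now rewrite IH, Fshift.
Qed.

Lemma lift_shift_IZR (F : R -> R) (k : Z) (x : R) :
  is_lift F -> F (x + IZR k) = F x + IZR k.
Proof.
  intros [_ Fshift]; revert x.
  induction k as [|k IH|k IH] using Z.peano_ind; intros x.
  - now rewrite !Rplus_0_r.
  - rewrite succ_IZR, <- Rplus_assoc, Fshift, IH; ring.
  - rewrite <- Z.sub_1_r, minus_IZR.
    generalize (Fshift (x + (IZR k - 1))).
    replace (x + (IZR k - 1) + 1) with (x + IZR k) by ring.
    rewrite IH; lra.
Qed.

(** Up to an integer translation, [y <= x < y + 1], and then monotonicity traps
    [F x] between [F y] and [F y + 1]. *)
Lemma lift_displacement (F : R -> R) (x y : R) :
  is_lift F -> Rabs ((F x - x) - (F y - y)) <= 1.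
Proof.
  intros HF.
  destruct (base_Int_part (x - y)) as [k1 k2].
  set (k := Int_part (x - y)) in *.
  generalize (lift_shift_IZR F k y HF) (lift_shift_IZR F (k + 1) y HF).
  rewrite plus_IZR; intros e0 e1.
  destruct HF as [Fmono _].
  assert (l0 : F (y + IZR k) <= F x) by (apply Fmono; lra).
  assert (l1 : F x <= F (y + (IZR k + 1))) by (apply Fmono; lra).
  apply Rabs_le; lra.
Qed.

Lemma is_lim_seq_div_INR (c : R) :
  is_lim_seq (fun n : nat => c / INR n) (Finite 0).
Proof.
  replace (Finite 0) with (Rbar_mult c (Rbar_inv p_infty))
    by (simpl; f_equal; ring).
  apply is_lim_seq_scal_l, is_lim_seq_inv; [apply is_lim_seq_INR|discriminate].
Qed.

Lemma quasi_additive_mul (u : nat -> R) :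
  (forall n m : nat, Rabs (u (n + m)%nat - u n - u m) <= 1) ->
  forall n m : nat, Rabs (u (m * n)%nat - INR m * u n) <= INR m + 1.
Proof.
  intros Hu n m; induction m as [|m IH].
  - generalize (Hu 0%nat 0%nat); simpl Nat.add; simpl Nat.mul; simpl INR.
    intros H; apply Rabs_le_between in H; apply Rabs_le; lra.
  - rewrite S_INR; simpl Nat.mul.
    generalize (Hu n (m * n)%nat); intros H.
    apply Rabs_le_between in H; apply Rabs_le_between in IH; apply Rabs_le; lra.
Qed.

(** Comparing [u (m * n)] with both [m * u n] and [n * u m] shows that
    [u n / n] and [u m / m] differ by [O(1/n + 1/m)]. *)
Lemma quasi_additive_ex_lim (u : nat -> R) :
  (forall n m : nat, Rabs (u (n + m)%nat - u n - u m) <= 1) ->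
  exists r : R, is_lim_seq (fun n : nat => u n / INR n) (Finite r).
Proof.
  intros Hu; apply ex_lim_seq_cauchy_corr; intros eps.
  generalize (proj2 (is_lim_seq_spec _ _) (is_lim_seq_div_INR 4) eps).
  intros [N HN]; exists (S N); intros n m Hn Hm.
  generalize (HN n ltac:(lia)) (HN m ltac:(lia)); rewrite !Rminus_0_r.
  assert (n1 : 1 <= INR n) by (apply (le_INR 1); lia).
  assert (m1 : 1 <= INR m) by (apply (le_INR 1); lia).
  assert (posdiv : forall x, 1 <= x -> 0 < 4 / x)
    by (intros x x1; apply Rdiv_lt_0_compat; lra).
  generalize (posdiv _ n1) (posdiv _ m1); intros pn pm.
  rewrite !Rabs_pos_eq by lra; intros en em.
  assert (key : Rabs (INR m * u n - INR n * u m) <= 2 * INR n + 2 * INR m).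
  { generalize (quasi_additive_mul u Hu n m) (quasi_additive_mul u Hu m n).
    rewrite (Nat.mul_comm n m); intros H1 H2.
    apply Rabs_le_between in H1; apply Rabs_le_between in H2.
    apply Rabs_le; lra. }
  replace (u n / INR n - u m / INR m)
    with ((INR m * u n - INR n * u m) / (INR n * INR m)) by (field; lra).
  assert (nm : 0 < INR n * INR m) by (apply Rmult_lt_0_compat; lra).
  unfold Rdiv; rewrite Rabs_mult, (Rabs_pos_eq (/ _))
    by (left; now apply Rinv_0_lt_compat).
  apply Rle_lt_trans with ((2 * INR n + 2 * INR m) * / (INR n * INR m)).
  - apply Rmult_le_compat_r; [left; now apply Rinv_0_lt_compat|exact key].
  - replace ((2 * INR n + 2 * INR m) * / (INR n * INR m))
      with ((4 / INR n + 4 / INR m) / 2) by (field; lra).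
    lra.
Qed.

(** Used to pass from one orbit to another, and from an orbit to its image in
    another coordinate. *)
Lemma is_lim_seq_mean_bounded (v w : nat -> R) (M l : R) :
  (forall n : nat, Rabs (w n - v n) <= M) ->
  is_lim_seq (fun n : nat => v n / INR n) (Finite l) ->
  is_lim_seq (fun n : nat => w n / INR n) (Finite l).
Proof.
  intros HM Hv.
  apply is_lim_seq_ext with (fun n => v n / INR n + (w n - v n) / INR n).
  { intros n; unfold Rdiv; ring. }
  replace (Finite l) with (Finite (l + 0)) by (f_equal; ring).
  apply is_lim_seq_plus'; [exact Hv|].
  apply is_lim_seq_abs_0.
  apply is_lim_seq_le_le_loc with (fun _ => 0) (fun n => M / INR n).
  - exists 1%nat; intros n Hn.
    assert (n1 : 1 <= INR n) by (apply (le_INR 1); lia).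
    split; [apply Rabs_pos|].
    unfold Rdiv; rewrite Rabs_mult, (Rabs_pos_eq (/ _))
      by (left; apply Rinv_0_lt_compat; lra).
    apply Rmult_le_compat_r; [left; apply Rinv_0_lt_compat; lra|apply HM].
  - apply is_lim_seq_const.
  - apply is_lim_seq_div_INR.
Qed.

(** Applying [lift_displacement] to the iterate [F ^ n] at the points
    [F ^ m 0] and [0] shows that [n |-> F ^ n 0] is additive up to [1], so it
    has a mean speed; applied at [x] and [0], it shows that all orbits share it. *)
Lemma ex_rotation_number (F : R -> R) :
  is_lift F -> exists r : R, is_rotation_number F r.
Proof.
  intros HF.
  assert (Hd : forall n x y,
             Rabs ((Nat.iter n F x - x) - (Nat.iter n F y - y)) <= 1).
  { intros n x y; apply lift_displacement, is_lift_iter, HF. }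
  destruct (quasi_additive_ex_lim (fun n => Nat.iter n F 0)) as [r Hr].
  { intros n m; rewrite Nat.iter_add.
    replace (Nat.iter n F (Nat.iter m F 0) - Nat.iter n F 0 - Nat.iter m F 0)
      with ((Nat.iter n F (Nat.iter m F 0) - Nat.iter m F 0)
            - (Nat.iter n F 0 - 0)) by ring.
    apply Hd. }
  exists r; intros x.
  apply is_lim_seq_mean_bounded with (2 := Hr) (M := 1).
  intros n; rewrite <- (Rminus_0_r (Nat.iter n F 0)); apply Hd.
Qed.

Lemma rotation_number_correct (F : R -> R) :
  is_lift F -> is_rotation_number F (rotation_number F).
Proof.
  intros HF.
  refine (iota_correct (V := R_CompleteNormedModule) (is_rotation_number F) _).
  destruct (ex_rotation_number F HF) as [r Hr].
  exists r; split; [exact Hr|].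
  intros s Hs; generalize (Hs 0) (Hr 0); intros H1 H2.
  apply is_lim_seq_unique in H1; apply is_lim_seq_unique in H2.
  congruence.
Qed.

(** * Comparison through a change of coordinate *)

Lemma rotation_number_in_coordinate (F h : R -> R) (M : R) :
  is_lift F ->
  (forall x : R, Rabs (h x - x) <= M) ->
  is_lim_seq (fun n : nat => (h (Nat.iter n F 0) - h 0) / INR n)
    (Finite (rotation_number F)).
Proof.
  intros HF HM.
  apply is_lim_seq_mean_bounded with (2 := rotation_number_correct F HF 0)
                                     (M := 2 * M).
  intros n; generalize (HM (Nat.iter n F 0)) (HM 0); intros H1 H2.
  apply Rabs_le_between in H1; apply Rabs_le_between in H2.
  apply Rabs_le; lra.
Qed.

Lemma rotation_number_le (F h : R -> R) (M d : R) :
  is_lift F ->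
  (forall x : R, Rabs (h x - x) <= M) ->
  (forall x : R, h (F x) - h x <= d) ->
  rotation_number F <= d.
Proof.
  intros HF HM Hd.
  refine (is_lim_seq_le_loc _ _ _ (Finite d) _
            (rotation_number_in_coordinate F h M HF HM) (is_lim_seq_const d)).
  exists 1%nat; intros n Hn.
  assert (n1 : 1 <= INR n) by (apply (le_INR 1); lia).
  apply Rle_div_l; [lra|].
  clear Hn n1; induction n as [|n IH]; [simpl; lra|].
  rewrite S_INR; simpl Nat.iter; generalize (Hd (Nat.iter n F 0)); lra.
Qed.

Lemma rotation_number_ge (F h : R -> R) (M d : R) :
  is_lift F ->
  (forall x : R, Rabs (h x - x) <= M) ->
  (forall x : R, d <= h (F x) - h x) ->
  d <= rotation_number F.
Proof.
  intros HF HM Hd.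
  refine (is_lim_seq_le_loc _ _ (Finite d) _ _
            (is_lim_seq_const d) (rotation_number_in_coordinate F h M HF HM)).
  exists 1%nat; intros n Hn.
  assert (n1 : 1 <= INR n) by (apply (le_INR 1); lia).
  apply Rle_div_r; [lra|].
  clear Hn n1; induction n as [|n IH]; [simpl; lra|].
  rewrite S_INR; simpl Nat.iter; generalize (Hd (Nat.iter n F 0)); lra.
Qed.

(** * Arnold maps away from the resonance at zero *)

Lemma Rabs_mult_le_l (c s : R) : -1 <= s <= 1 -> Rabs (c * s) <= Rabs c.
Proof.
  intros Hs; apply Rabs_le in Hs.
  rewrite Rabs_mult; generalize (Rabs_pos c); nra.
Qed.

Lemma sin_lipschitz (x y : R) : Rabs (sin y - sin x) <= Rabs (y - x).
Proof.
  rewrite <- (Rmult_1_l (Rabs (y - x))).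
  apply bounded_variation with cos; intros t _; split.
  - auto_derive; [exact I|ring].
  - apply Rabs_le, COS_bound.
Qed.

Lemma cos_lipschitz (x y : R) : Rabs (cos y - cos x) <= Rabs (y - x).
Proof.
  rewrite !cos_sin.
  replace (y - x) with ((PI / 2 + y) - (PI / 2 + x)) by ring.
  apply sin_lipschitz.
Qed.

Lemma arnold_is_lift (alpha beta : R) :
  Rabs beta <= 1 / (2 * PI) -> is_lift (fun x => arnold x alpha beta).
Proof.
  intros Hb; unfold arnold; generalize PI_RGT_0; intros pi0; split.
  - intros x y xy.
    assert (H : Rabs (beta * (sin (2 * PI * y) - sin (2 * PI * x))) <= y - x).
    { rewrite Rabs_mult.
      apply Rle_trans with (1 / (2 * PI) * Rabs (2 * PI * y - 2 * PI * x)).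
      - apply Rmult_le_compat; try apply Rabs_pos; [exact Hb|apply sin_lipschitz].
      - rewrite Rabs_pos_eq.
        + right; field; lra.
        + rewrite <- Rmult_minus_distr_l; apply Rmult_le_pos; lra. }
    apply Rabs_le_between in H; lra.
  - intros x.
    replace (2 * PI * (x + 1)) with (2 * PI * x + 2 * PI) by ring.
    rewrite sin_plus, cos_2PI, sin_2PI; ring.
Qed.

(** First-order averaging.  The correction [k x = c * cos (2 PI x - PI alpha)]
    solves [k (x + alpha) - k x = - beta * sin (2 PI x)], which is possible as
    long as [sin (PI * alpha) <> 0].  The true step is [alpha + beta * sin],
    not [alpha], and this costs one more factor [beta] through the Lipschitz
    constant of [k]: whence a bound quadratic in [beta]. *)
Lemma rotation_number_nonresonant (alpha beta : R) :
  Rabs beta <= 1 / (2 * PI) -> sin (PI * alpha) <> 0 ->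
  Rabs (rotation_number (fun x => arnold x alpha beta) - alpha)
    <= PI / Rabs (sin (PI * alpha)) * beta ^ 2.
Proof.
  intros Hb Hs.
  assert (HF := arnold_is_lift alpha beta Hb).
  generalize PI_RGT_0; intros pi0.
  set (c := beta / (2 * sin (PI * alpha))).
  pose (h := fun x => x + c * cos (2 * PI * x - PI * alpha)).
  set (E := PI / Rabs (sin (PI * alpha)) * beta ^ 2).
  assert (Hh : forall x, Rabs (h x - x) <= Rabs c).
  { intros x; unfold h.
    replace (x + c * cos (2 * PI * x - PI * alpha) - x)
      with (c * cos (2 * PI * x - PI * alpha)) by ring.
    apply Rabs_mult_le_l, COS_bound. }
  assert (main : forall x, Rabs (h (arnold x alpha beta) - h x - alpha) <= E).
  { intros x; unfold h, arnold.
    set (s := sin (2 * PI * x)).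
    assert (cob : c * (cos (2 * PI * x + PI * alpha)
                       - cos (2 * PI * x - PI * alpha)) = - (beta * s)).
    { rewrite cos_plus, cos_minus; unfold c, s; field; exact Hs. }
    replace (x + alpha + beta * s
        + c * cos (2 * PI * (x + alpha + beta * s) - PI * alpha)
        - (x + c * cos (2 * PI * x - PI * alpha)) - alpha)
      with (c * (cos (2 * PI * (x + alpha + beta * s) - PI * alpha)
                 - cos (2 * PI * x + PI * alpha))) by lra.
    rewrite Rabs_mult.
    apply Rle_trans with (Rabs c * (2 * PI * Rabs beta)).
    - apply Rmult_le_compat_l; [apply Rabs_pos|].
      eapply Rle_trans; [apply cos_lipschitz|].
      replace (2 * PI * (x + alpha + beta * s) - PI * alpha
                 - (2 * PI * x + PI * alpha)) with (2 * PI * beta * s) by ring.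
      replace (2 * PI * Rabs beta) with (Rabs (2 * PI * beta))
        by (rewrite Rabs_mult, (Rabs_pos_eq (2 * PI)); lra).
      apply Rabs_mult_le_l, SIN_bound.
    - right; unfold E, c, Rdiv.
      rewrite <- (pow2_abs beta), Rabs_mult, Rabs_inv, Rabs_mult.
      rewrite (Rabs_pos_eq 2) by lra.
      field; now apply Rabs_no_R0. }
  apply Rabs_le; split.
  - assert (H : alpha - E <= rotation_number (fun x => arnold x alpha beta)).
    { apply (rotation_number_ge _ h (Rabs c)); auto.
      intros x; generalize (main x); intros H; apply Rabs_le_between in H; lra. }
    lra.
  - assert (H : rotation_number (fun x => arnold x alpha beta) <= alpha + E).
    { apply (rotation_number_le _ h (Rabs c)); auto.
      intros x; generalize (main x); intros H; apply Rabs_le_between in H; lra. }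
    lra.
Qed.

(** * Derivative along a nonresonant path *)

Lemma is_derive_0_iff (f : R -> R) (l : R) :
  is_derive f 0 l <->
  forall eps : R, 0 < eps ->
    locally 0 (fun mu : R => Rabs (f mu - f 0 - mu * l) <= eps * Rabs mu).
Proof.
  split.
  - intros [_ H] eps eps0.
    generalize (H 0 (fun P HP => HP) (mkposreal eps eps0)).
    apply filter_imp; intros mu.
    change (Rabs ((f mu - f 0) - (mu - 0) * l) <= eps * Rabs (mu - 0)
            -> Rabs (f mu - f 0 - mu * l) <= eps * Rabs mu).
    now rewrite Rminus_0_r.
  - intros H; split; [apply is_linear_scal_l|].
    intros x Hx eps.
    rewrite <- (is_filter_lim_locally_unique (K := R_AbsRing) (V := R_NormedModule) _ _ Hx).
    generalize (H eps (cond_pos eps)).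
    apply filter_imp; intros mu.
    change (Rabs (f mu - f 0 - mu * l) <= eps * Rabs mu ->
            Rabs ((f mu - f 0) - (mu - 0) * l) <= eps * Rabs (mu - 0)).
    now rewrite Rminus_0_r.
Qed.

Lemma continuous_locally_Rabs_le (f : R -> R) (M : R) :
  continuous f 0 -> Rabs (f 0) < M -> locally 0 (fun mu => Rabs (f mu) <= M).
Proof.
  intros Hc H0.
  assert (Hloc : locally (Rabs (f 0)) (fun y => y < M)) by now apply open_lt.
  generalize (continuous_comp f Rabs 0 Hc (continuous_Rabs _) _ Hloc).
  unfold filtermap; apply filter_imp; intros mu; lra.
Qed.

Lemma is_derive_0_quadratic (g beta : R -> R) (K : R) :
  0 <= K -> ex_derive beta 0 -> beta 0 = 0 ->
  locally 0 (fun mu => Rabs (g mu) <= K * beta mu ^ 2) ->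
  is_derive g 0 0.
Proof.
  intros K0 [b Hb] b0 Hg.
  assert (g0 : g 0 = 0).
  { generalize (locally_singleton _ _ Hg); rewrite b0; intros H.
    apply Rabs_le_between in H; lra. }
  assert (H : is_derive (fun mu => K * beta mu ^ 2) 0 0).
  { evar_last; [apply is_derive_scal, is_derive_pow, Hb|].
    simpl; rewrite b0; ring. }
  apply is_derive_0_iff; intros eps eps0.
  generalize (filter_and _ _ Hg (proj1 (is_derive_0_iff _ _) H eps eps0)).
  apply filter_imp; intros mu [H1 H2].
  rewrite g0, Rmult_0_r, !Rminus_0_r.
  rewrite b0, Rmult_0_r in H2; simpl in H2.
  replace (K * (beta mu * (beta mu * 1)) - K * (0 * (0 * 1)) - 0)
    with (K * beta mu ^ 2) in H2 by ring.
  eapply Rle_trans; [exact H1|].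
  eapply Rle_trans; [apply Rle_abs|exact H2].
Qed.

Definition path_rotation (alpha beta : R -> R) (mu : R) : R :=
  rotation_number (fun x => arnold x (alpha mu) (beta mu)).

Lemma locally_small_beta (beta : R -> R) :
  ex_derive beta 0 -> beta 0 = 0 ->
  locally 0 (fun mu => Rabs (beta mu) <= 1 / (2 * PI)).
Proof.
  intros Hb b0; apply continuous_locally_Rabs_le.
  - now apply (ex_derive_continuous (K := R_AbsRing) (V := R_NormedModule)).
  - rewrite b0, Rabs_R0; generalize PI_RGT_0; intros H.
    apply Rdiv_lt_0_compat; lra.
Qed.

Lemma is_derive_rotation_nonresonant (alpha beta : R -> R) (a : R) :
  is_derive alpha 0 a -> ex_derive beta 0 -> beta 0 = 0 ->
  0 < sin (PI * alpha 0) ->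
  is_derive (path_rotation alpha beta) 0 a.
Proof.
  set (rho := path_rotation alpha beta).
  intros Ha Hb b0 Hsin.
  set (s0 := sin (PI * alpha 0)) in *.
  generalize PI_RGT_0; intros pi0.
  assert (Hs : locally 0 (fun mu => s0 / 2 < sin (PI * alpha mu))).
  { assert (Hloc : locally s0 (fun y => s0 / 2 < y)) by (apply open_gt; lra).
    assert (Hc : continuous (fun mu => sin (PI * alpha mu)) 0).
    { apply (ex_derive_continuous (K := R_AbsRing) (V := R_NormedModule)).
      auto_derive; exists a; exact Ha. }
    exact (Hc _ Hloc). }
  assert (Hg : is_derive (fun mu => rho mu - alpha mu) 0 0).
  { apply is_derive_0_quadratic with beta (PI / (s0 / 2)); auto.
    { apply Rdiv_le_0_compat; lra. }
    generalize (filter_and _ _ Hs (locally_small_beta beta Hb b0)).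
    apply filter_imp; intros mu [s1 s2].
    eapply Rle_trans; [apply rotation_number_nonresonant; lra|].
    apply Rmult_le_compat_r; [apply pow2_ge_0|].
    rewrite Rabs_pos_eq by lra.
    apply Rmult_le_compat_l; [lra|apply Rinv_le_contravar; lra]. }
  apply (is_derive_ext (fun mu => alpha mu + (rho mu - alpha mu))).
  { intros mu; change (alpha mu + (rho mu - alpha mu) = rho mu); ring. }
  rewrite <- (Rplus_0_r a).
  now apply (is_derive_plus (V := R_NormedModule)).
Qed.

(** * Straightening the flow of a + b sin *)

Lemma Rsqr_sub_pos (A B : R) : Rabs B < Rabs A -> 0 < A ^ 2 - B ^ 2.
Proof.
  intros AB.
  rewrite <- (pow2_abs A), <- (pow2_abs B).
  generalize (Rabs_pos B); nra.
Qed.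

(** Mean speed of the flow [x' = A + B sin (2 PI x)].  It is [0] when
    [|A| <= |B|], since [sqrt] vanishes on negative numbers: the flow then has
    rest points. *)
Definition mean_speed (A B : R) : R := sign A * sqrt (A ^ 2 - B ^ 2).

Lemma mean_speed_sqr (A B : R) :
  Rabs B < Rabs A -> mean_speed A B ^ 2 = A ^ 2 - B ^ 2.
Proof.
  intros AB; unfold mean_speed.
  generalize (Rsqr_sub_pos A B AB); intros pos.
  rewrite Rpow_mult_distr, pow2_sqrt by lra.
  destruct (Rtotal_order A 0) as [A0|[A0|A0]].
  - rewrite sign_eq_m1 by exact A0; ring.
  - subst A; rewrite Rabs_R0 in AB; generalize (Rabs_pos B); lra.
  - rewrite sign_eq_1 by exact A0; ring.
Qed.

Lemma mean_speed_same_sign (A B : R) :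
  Rabs B < Rabs A -> 0 < A * mean_speed A B.
Proof.
  intros AB; unfold mean_speed.
  generalize (sqrt_lt_R0 _ (Rsqr_sub_pos A B AB)); intros pos.
  destruct (Rtotal_order A 0) as [A0|[A0|A0]].
  - rewrite sign_eq_m1 by exact A0; nra.
  - subst A; rewrite Rabs_R0 in AB; generalize (Rabs_pos B); lra.
  - rewrite sign_eq_1 by exact A0; nra.
Qed.

(** [A + B sin] is a multiple of the denominator [1 + 2 c sin + c ^ 2] of a Poisson
    kernel.  The equation [B / A = 2 c / (1 + c ^ 2)] has the root
    [c = B / (A + r)], with [|c| < 1], where [r] is the mean speed. *)
Lemma poisson_parameter (A B : R) :
  Rabs B < Rabs A ->
  exists c s : R, Rabs c < 1 /\ A = s * (1 + c ^ 2) /\ B = s * (2 * c) /\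
    mean_speed A B = s * (1 - c ^ 2).
Proof.
  intros AB.
  generalize (mean_speed_sqr A B AB) (mean_speed_same_sign A B AB).
  set (r := mean_speed A B); intros r2 Ar.
  assert (A0 : A <> 0) by (intros A0; rewrite A0 in Ar; lra).
  assert (Ar0 : A + r <> 0).
  { intros e; assert (r = - A) by lra; subst r; nra. }
  assert (B2 : B ^ 2 = A ^ 2 - r ^ 2) by lra.
  exists (B / (A + r)), ((A + r) / 2); repeat split.
  - assert (c2 : (B / (A + r)) ^ 2 < 1 ^ 2).
    { replace ((B / (A + r)) ^ 2) with (B ^ 2 / (A + r) ^ 2) by (field; lra).
      apply Rlt_div_l; [nra|].
      rewrite B2; nra. }
    rewrite <- (pow2_abs (B / (A + r))) in c2.
    generalize (Rabs_pos (B / (A + r))); nra.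
  - replace ((A + r) / 2 * (1 + (B / (A + r)) ^ 2))
      with (((A + r) ^ 2 + B ^ 2) / (2 * (A + r))) by (field; lra).
    rewrite B2; field; lra.
  - field; lra.
  - replace ((A + r) / 2 * (1 - (B / (A + r)) ^ 2))
      with (((A + r) ^ 2 - B ^ 2) / (2 * (A + r))) by (field; lra).
    rewrite B2; field; lra.
Qed.

(** The coordinate [h] has derivative proportional to [1 / (A + B sin)], so that
    it moves at constant speed along the flow.  With [c] from
    [poisson_parameter], this derivative is the Poisson kernel
    [(1 - c ^ 2) / (1 + 2 c sin + c ^ 2)].  Its mean is [1], hence [h] stays near
    the identity; the closed form
    [x + atan (c cos / (1 + c sin)) / PI] of the primitive makes this visible,
    as [atan] is bounded and its argument has no pole. *)
Lemma straightening_coordinate (A B : R) :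
  Rabs B < Rabs A ->
  exists (h dh : R -> R) (K L : R),
    0 <= K /\ 0 <= L /\
    (forall x : R, Rabs (h x - x) <= 1) /\
    (forall x : R, is_derive h x (dh x)) /\
    (forall x : R, 0 <= dh x <= L) /\
    (forall x y : R, Rabs (dh y - dh x) <= K * Rabs (y - x)) /\
    (forall x : R, dh x * (A + B * sin (2 * PI * x)) = mean_speed A B).
Proof.
  intros AB; destruct (poisson_parameter A B AB) as (c & s & c1 & eA & eB & er).
  rewrite er, eA, eB; clear er eA eB AB A B.
  generalize PI_RGT_0; intros pi0.
  assert (c1' := c1); apply Rabs_lt_between in c1'.
  pose (D := fun x => 1 + 2 * c * sin (2 * PI * x) + c ^ 2).
  pose (m := (1 - Rabs c) ^ 2).
  assert (m0 : 0 < m) by (unfold m; nra).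
  assert (cs : forall x, Rabs (c * sin (2 * PI * x)) <= Rabs c).
  { intros x; apply Rabs_mult_le_l, SIN_bound. }
  assert (Dm : forall x, m <= D x).
  { intros x; unfold D, m; generalize (cs x); intros H.
    apply Rabs_le_between in H; rewrite <- (pow2_abs c); lra. }
  assert (c2 : c ^ 2 < 1) by nra.
  exists (fun x => x + atan (c * cos (2 * PI * x) / (1 + c * sin (2 * PI * x))) / PI).
  exists (fun x => (1 - c ^ 2) / D x).
  exists ((1 - c ^ 2) * (2 * Rabs c * (2 * PI)) / (m * m)), ((1 - c ^ 2) / m).
  refine (conj _ (conj _ (conj _ (conj _ (conj _ (conj _ _)))))).
  - apply Rdiv_le_0_compat; [|nra].
    generalize (Rabs_pos c); intros H.
    apply Rmult_le_pos; [lra|apply Rmult_le_pos; lra].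
  - apply Rdiv_le_0_compat; lra.
  - intros x.
    match goal with |- Rabs (x + atan ?u / PI - x) <= 1 =>
      replace (x + atan u / PI - x) with (atan u / PI) by ring;
      generalize (atan_bound u) end.
    intros [l1 l2].
    apply Rabs_le; split; [apply Rle_div_r|apply Rle_div_l]; lra.
  - intros x.
    assert (den : 0 < 1 + c * sin (2 * PI * x)).
    { generalize (cs x); intros H; apply Rabs_le_between in H; lra. }
    assert (Dx : 0 < D x) by (generalize (Dm x); lra).
    set (w := fun t => c * cos (2 * PI * t) / (1 + c * sin (2 * PI * t))).
    assert (dw : is_derive w x (- (2 * PI) * (c * sin (2 * PI * x) + c ^ 2)
                                / (1 + c * sin (2 * PI * x)) ^ 2)).
    { unfold w; auto_derive; [lra|].
      replace (c ^ 2) with (c ^ 2 * (sin (2 * PI * x) ^ 2 + cos (2 * PI * x) ^ 2))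
        by (rewrite <- !Rsqr_pow2, sin2_cos2; ring).
      field; lra. }
    apply (is_derive_ext (fun t => t + / PI * atan (w t))).
    { intros t; exact (f_equal (Rplus t) (Rmult_comm _ _)). }
    evar_last.
    { apply (is_derive_plus (V := R_NormedModule)); [apply is_derive_id|].
      apply is_derive_scal.
      apply (is_derive_comp (V := R_NormedModule) atan w);
        [apply is_derive_atan|exact dw]. }
    change (1 + / PI * (- (2 * PI) * (c * sin (2 * PI * x) + c ^ 2)
                  / (1 + c * sin (2 * PI * x)) ^ 2 *
       / (1 + (c * cos (2 * PI * x) / (1 + c * sin (2 * PI * x)))²)) =
       (1 - c ^ 2) / D x).
    (* the chain rule gives the kernel since [(1 + c sin)^2 + (c cos)^2 = D] *)
    assert (e : 1 + (c * cos (2 * PI * x) / (1 + c * sin (2 * PI * x)))²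
            = D x / (1 + c * sin (2 * PI * x)) ^ 2).
    { rewrite Rsqr_div', Rsqr_mult.
      replace ((cos (2 * PI * x))²) with (1 - (sin (2 * PI * x))²)
        by (generalize (sin2_cos2 (2 * PI * x)); lra).
      unfold D, Rsqr; field; lra. }
    rewrite e; unfold D in *; field; repeat split; lra.
  - intros x; split.
    + apply Rdiv_le_0_compat; [lra|generalize (Dm x); lra].
    + apply Rmult_le_compat_l; [lra|].
      apply Rinv_le_contravar; [exact m0|apply Dm].
  - intros x y.
    generalize (Dm x) (Dm y); intros Dx Dy.
    replace ((1 - c ^ 2) / D y - (1 - c ^ 2) / D x)
      with ((1 - c ^ 2) * (2 * c * (sin (2 * PI * x) - sin (2 * PI * y)))
            * / (D x * D y)) by (unfold D in *; field; split; lra).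
    rewrite Rabs_mult, Rabs_mult, Rabs_mult, (Rabs_mult 2).
    rewrite (Rabs_pos_eq (1 - c ^ 2)), (Rabs_pos_eq 2) by lra.
    rewrite (Rabs_pos_eq (/ _)) by (left; apply Rinv_0_lt_compat; nra).
    apply Rle_trans with ((1 - c ^ 2) * (2 * Rabs c * (2 * PI * Rabs (y - x)))
                          * / (m * m)); [|right; field; lra].
    assert (0 <= Rabs c) by apply Rabs_pos.
    apply Rmult_le_compat.
    + apply Rmult_le_pos; [lra|apply Rmult_le_pos; [lra|apply Rabs_pos]].
    + left; apply Rinv_0_lt_compat; nra.
    + apply Rmult_le_compat_l; [lra|].
      apply Rmult_le_compat_l; [lra|].
      eapply Rle_trans; [apply sin_lipschitz|].
      rewrite <- Rmult_minus_distr_l, Rabs_mult, (Rabs_pos_eq (2 * PI)) by lra.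
      right; f_equal; apply Rabs_minus_sym.
    + apply Rinv_le_contravar; [nra|].
      apply Rmult_le_compat; lra.
  - intros x; generalize (Dm x); unfold D; intros Dx; field; lra.
Qed.

Lemma taylor_lipschitz (h dh : R -> R) (K x d : R) :
  0 <= K ->
  (forall y : R, is_derive h y (dh y)) ->
  (forall y z : R, Rabs (dh z - dh y) <= K * Rabs (z - y)) ->
  Rabs (h (x + d) - h x - dh x * d) <= K * d ^ 2.
Proof.
  intros K0 Hd Hlip.
  pose (g := fun y => h y - y * dh x).
  replace (h (x + d) - h x - dh x * d) with (g (x + d) - g x)
    by (unfold g; ring).
  replace (K * d ^ 2) with (K * Rabs d * Rabs (x + d - x)).
  2: { replace (x + d - x) with d by ring; rewrite <- (pow2_abs d); ring. }
  apply bounded_variation with (fun y => dh y - dh x).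
  intros y Hy; split.
  - unfold g; apply (is_derive_minus (V := R_NormedModule)); [apply Hd|].
    auto_derive; [exact I|ring].
  - eapply Rle_trans; [apply Hlip|].
    apply Rmult_le_compat_l; [exact K0|].
    now replace d with (x + d - x) by ring.
Qed.

(** In the straightening coordinate a displacement [t * (A + B sin)] reads
    exactly [t * mean_speed A B].  A displacement lying on one side of it up to
    [eta] therefore bounds the rotation number on that side, up to [eta] times
    the maximal slope of the coordinate and a second-order Taylor remainder.
    Keeping the two sides apart lets a path be compared with flows that are
    only faster, or only slower, than its own linearization. *)
Lemma rotation_number_comparison (A B : R) :
  Rabs B < Rabs A ->
  exists K L : R, 0 <= K /\ 0 <= L /\
    forall alpha beta t eta : R, Rabs beta <= 1 / (2 * PI) -> 0 <= eta ->
      let rho := rotation_number (fun x => arnold x alpha beta) in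
      let err := L * eta + K * (Rabs alpha + Rabs beta) ^ 2 in
      ((forall s : R, -1 <= s <= 1 -> alpha + beta * s <= t * (A + B * s) + eta) ->
        rho <= t * mean_speed A B + err) /\
      ((forall s : R, -1 <= s <= 1 -> t * (A + B * s) - eta <= alpha + beta * s) ->
        t * mean_speed A B - err <= rho).
Proof.
  intros AB.
  destruct (straightening_coordinate A B AB)
    as (h & dh & K & L & K0 & L0 & Hh & Hdh & HL & Hlip & Hstr).
  exists K, L; repeat (split; [assumption|]).
  intros alpha beta t eta Hb eta0; cbv zeta.
  assert (HF := arnold_is_lift alpha beta Hb).
  assert (step : forall x,
    Rabs (h (arnold x alpha beta) - h x
          - dh x * (alpha + beta * sin (2 * PI * x)))
      <= K * (Rabs alpha + Rabs beta) ^ 2).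
  { intros x; unfold arnold; rewrite Rplus_assoc.
    eapply Rle_trans; [apply (taylor_lipschitz h dh K); assumption|].
    apply Rmult_le_compat_l; [exact K0|].
    rewrite <- pow2_abs; apply pow_incr; split; [apply Rabs_pos|].
    eapply Rle_trans; [apply Rabs_triang|].
    apply Rplus_le_compat_l, Rabs_mult_le_l, SIN_bound. }
  split; intros Hs.
  - apply (rotation_number_le _ h 1); auto; intros x.
    generalize (step x) (HL x) (Hs _ (SIN_bound (2 * PI * x))) (Hstr x).
    intros H [H1 H2] H3 H4; apply Rabs_le_between in H.
    rewrite <- H4.
    assert (dh x * (alpha + beta * sin (2 * PI * x)) <=
            dh x * (t * (A + B * sin (2 * PI * x)) + eta))
      by (apply Rmult_le_compat_l; assumption).
    assert (dh x * eta <= L * eta) by (apply Rmult_le_compat_r; assumption).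
    lra.
  - apply (rotation_number_ge _ h 1); auto; intros x.
    generalize (step x) (HL x) (Hs _ (SIN_bound (2 * PI * x))) (Hstr x).
    intros H [H1 H2] H3 H4; apply Rabs_le_between in H.
    rewrite <- H4.
    assert (dh x * (t * (A + B * sin (2 * PI * x)) - eta) <=
            dh x * (alpha + beta * sin (2 * PI * x)))
      by (apply Rmult_le_compat_l; assumption).
    assert (dh x * eta <= L * eta) by (apply Rmult_le_compat_r; assumption).
    lra.
Qed.

(** * Derivative along a path through the origin *)

Lemma path_rotation_0 (alpha beta : R -> R) :
  alpha 0 = 0 -> beta 0 = 0 -> path_rotation alpha beta 0 = 0.
Proof.
  intros a0 b0; unfold path_rotation; rewrite a0, b0.
  assert (HF : is_lift (fun x => arnold x 0 0)).
  { apply arnold_is_lift; rewrite Rabs_R0.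
    generalize PI_RGT_0; intros H; apply Rdiv_le_0_compat; lra. }
  assert (H0 : forall x, Rabs (x - x) <= 0)
    by (intros x; rewrite Rminus_diag, Rabs_R0; lra).
  apply Rle_antisym.
  - apply (rotation_number_le _ (fun x => x) 0); auto.
    intros x; unfold arnold; lra.
  - apply (rotation_number_ge _ (fun x => x) 0); auto.
    intros x; unfold arnold; lra.
Qed.

(** For a flow with the same [b] and no rest point, the sign of [mu * (A - a)]
    tells which of the two moves ahead over the time [mu], whatever the sign of
    [mu]. *)
Lemma path_rotation_one_sided (alpha beta : R -> R) (a b A eps : R) :
  is_derive alpha 0 a -> is_derive beta 0 b -> alpha 0 = 0 -> beta 0 = 0 ->
  Rabs b < Rabs A -> 0 < eps ->
  locally 0 (fun mu =>
    let rho := path_rotation alpha beta in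
    (mu * a <= mu * A -> rho mu <= mu * mean_speed A b + eps * Rabs mu) /\
    (mu * A <= mu * a -> mu * mean_speed A b - eps * Rabs mu <= rho mu)).
Proof.
  intros Ha Hb a0 b0 AB eps0; cbv zeta.
  destruct (rotation_number_comparison A b AB) as (K & L & K0 & L0 & H).
  set (C := Rabs a + Rabs b + 2).
  (* [e1] controls the linearization errors of [alpha] and [beta], which the
     comparison multiplies by [L]; together with the remainder, of size
     [K * (C * mu) ^ 2], they must stay below [eps * |mu|] *)
  set (e1 := Rmin 1 (eps / (4 * (L + 1)))).
  assert (e1_1 : e1 <= 1) by apply Rmin_l.
  assert (e1_L : L * (2 * e1) <= eps / 2).
  { assert (e1 * (4 * (L + 1)) <= eps)
      by (apply Rle_div_r; [lra|apply Rmin_r]).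
    assert (0 <= e1) by (apply Rmin_glb; [lra|apply Rdiv_le_0_compat; lra]).
    lra. }
  assert (e1_0 : 0 < e1)
    by (apply Rmin_glb_lt; [lra|apply Rdiv_lt_0_compat; lra]).
  assert (KC : 0 <= K * C ^ 2)
    by (apply Rmult_le_pos; [exact K0|apply pow2_ge_0]).
  assert (Hmu : locally 0 (fun mu => Rabs mu <= eps / (2 * (K * C ^ 2 + 1)))).
  { apply (continuous_locally_Rabs_le (fun mu => mu)); [apply continuous_id|].
    rewrite Rabs_R0; apply Rdiv_lt_0_compat; lra. }
  generalize (filter_and _ _ Hmu (filter_and _ _
    (locally_small_beta beta (ex_intro _ b Hb) b0)
    (filter_and _ _ (proj1 (is_derive_0_iff _ _) Ha e1 e1_0)
                    (proj1 (is_derive_0_iff _ _) Hb e1 e1_0)))).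
  apply filter_imp; intros mu (small & smallb & da & db).
  rewrite a0, Rminus_0_r in da; rewrite b0, Rminus_0_r in db.
  assert (mu0 := Rabs_pos mu).
  assert (err : L * (2 * e1 * Rabs mu) + K * (Rabs (alpha mu) + Rabs (beta mu)) ^ 2
                <= eps * Rabs mu).
  { assert (H1 : L * (2 * e1) * Rabs mu <= eps / 2 * Rabs mu)
      by (apply Rmult_le_compat_r; assumption).
    assert (e1mu : e1 * Rabs mu <= 1 * Rabs mu)
      by (apply Rmult_le_compat_r; assumption).
    assert (H2 : Rabs (alpha mu) + Rabs (beta mu) <= C * Rabs mu).
    { assert (Rabs (alpha mu) <= (Rabs a + 1) * Rabs mu).
      { replace (alpha mu) with (mu * a + (alpha mu - mu * a)) by ring.
        eapply Rle_trans; [apply Rabs_triang|]; rewrite Rabs_mult; lra. }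
      assert (Rabs (beta mu) <= (Rabs b + 1) * Rabs mu).
      { replace (beta mu) with (mu * b + (beta mu - mu * b)) by ring.
        eapply Rle_trans; [apply Rabs_triang|]; rewrite Rabs_mult; lra. }
      unfold C; lra. }
    assert (H3 : K * (Rabs (alpha mu) + Rabs (beta mu)) ^ 2
                 <= K * (C * Rabs mu) ^ 2).
    { apply Rmult_le_compat_l; [exact K0|].
      apply pow_incr; split; [|exact H2].
      generalize (Rabs_pos (alpha mu)) (Rabs_pos (beta mu)); lra. }
    assert (H4 : (K * C ^ 2) * Rabs mu <= eps / 2).
    { apply Rle_div_r in small; [|lra]; nra. }
    assert (H5 : (K * C ^ 2) * Rabs mu * Rabs mu <= eps / 2 * Rabs mu)
      by (apply Rmult_le_compat_r; assumption).
    nra. }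
  assert (eta0 : 0 <= 2 * e1 * Rabs mu) by (apply Rmult_le_pos; lra).
  destruct (H (alpha mu) (beta mu) mu (2 * e1 * Rabs mu) smallb eta0)
    as [Hup Hlow].
  fold (path_rotation alpha beta mu) in Hup, Hlow.
  assert (lin : forall s, -1 <= s <= 1 ->
    Rabs (alpha mu + beta mu * s - mu * (a + b * s)) <= 2 * e1 * Rabs mu).
  { intros s Hs.
    replace (alpha mu + beta mu * s - mu * (a + b * s))
      with ((alpha mu - mu * a) + (beta mu - mu * b) * s) by ring.
    eapply Rle_trans; [apply Rabs_triang|].
    generalize (Rabs_mult_le_l (beta mu - mu * b) s Hs); lra. }
  split; intros Haa.
  - eapply Rle_trans; [apply Hup|lra].
    intros s Hs; generalize (lin s Hs); intros Hl.
    apply Rabs_le_between in Hl; lra.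
  - eapply Rle_trans; [|apply Hlow]; [lra|].
    intros s Hs; generalize (lin s Hs); intros Hl.
    apply Rabs_le_between in Hl; lra.
Qed.

(** If [|b| < |a|], comparison with [A = a] works on both sides.  Otherwise [a]
    lies between [- A] and [A] for every [A > |b|], and the speeds
    [- sqrt (A ^ 2 - b ^ 2)] and [sqrt (A ^ 2 - b ^ 2)] enclose the derivative. *)
Lemma is_derive_rotation_resonant (alpha beta : R -> R) (a b : R) :
  is_derive alpha 0 a -> is_derive beta 0 b -> alpha 0 = 0 -> beta 0 = 0 ->
  is_derive (path_rotation alpha beta) 0 (mean_speed a b).
Proof.
  intros Ha Hb a0 b0.
  assert (sided := fun A eps =>
    path_rotation_one_sided alpha beta a b A eps Ha Hb a0 b0).
  apply is_derive_0_iff; intros eps eps0.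
  rewrite path_rotation_0 by assumption.
  destruct (Rlt_le_dec (Rabs b) (Rabs a)) as [ab|ab].
  - generalize (sided a eps ab eps0).
    apply filter_imp; intros mu [Hup Hlow].
    specialize (Hup (Rle_refl _)); specialize (Hlow (Rle_refl _)).
    apply Rabs_le; lra.
  - assert (r0 : mean_speed a b = 0).
    { unfold mean_speed; rewrite sqrt_neg_0; [ring|].
      rewrite <- (pow2_abs a), <- (pow2_abs b); generalize (Rabs_pos a); nra. }
    rewrite r0.
    set (e := eps / 2).
    (* so that the comparison flow has speed exactly [e] *)
    pose (A := sqrt (b ^ 2 + e ^ 2)).
    assert (A2 : A ^ 2 = b ^ 2 + e ^ 2) by (apply pow2_sqrt; nra).
    assert (bA : Rabs b < A).
    { unfold A; rewrite <- sqrt_Rsqr_abs; apply sqrt_lt_1_alt.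
      unfold Rsqr, e; split; nra. }
    assert (A0 : 0 < A) by (generalize (Rabs_pos b); lra).
    assert (e0 : 0 < e) by (unfold e; lra).
    assert (bA1 : Rabs b < Rabs A) by (rewrite (Rabs_pos_eq A); lra).
    assert (bA2 : Rabs b < Rabs (- A)) by (rewrite Rabs_Ropp; exact bA1).
    assert (v1 : mean_speed A b = e).
    { unfold mean_speed; rewrite sign_eq_1, A2 by exact A0.
      replace (b ^ 2 + e ^ 2 - b ^ 2) with (e ^ 2) by ring.
      rewrite sqrt_pow2; lra. }
    assert (v2 : mean_speed (- A) b = - e).
    { rewrite <- v1; unfold mean_speed; rewrite sign_opp.
      replace ((- A) ^ 2) with (A ^ 2) by ring; ring. }
    generalize (filter_and _ _ (sided A e bA1 e0)
                               (sided (- A) e bA2 e0)).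
    apply filter_imp; intros mu [[up1 low1] [up2 low2]].
    rewrite v1 in up1, low1; rewrite v2 in up2, low2.
    assert (aA : - A <= a <= A) by (apply Rabs_le_between; lra).
    replace (eps * Rabs mu) with (e * Rabs mu + e * Rabs mu)
      by (unfold e; field).
    destruct (Rle_lt_dec 0 mu) as [m0|m0].
    + specialize (up1 ltac:(nra)); specialize (low2 ltac:(nra)).
      rewrite (Rabs_pos_eq mu) in * by exact m0.
      apply Rabs_le; lra.
    + specialize (up2 ltac:(nra)); specialize (low1 ltac:(nra)).
      rewrite (Rabs_left mu) in * by exact m0.
      apply Rabs_le; lra.
Qed.

(** * Derivative of the rotation number at a rational rotation *)

Theorem theorem1p5 :
  forall (p q : Z) (alpha beta : R -> R),
    (0 <= p < q)%Z ->
    rel_prime p q ->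
    C1_near alpha 0 ->
    C1_near beta 0 ->
    alpha 0 = IZR p / IZR q ->
    beta 0 = 0 ->
    let rho := fun mu : R =>
      rotation_number (fun x : R => arnold x (alpha mu) (beta mu)) in
    (0 < Rabs (Derive alpha 0) ->
       ex_derive rho 0 /\
       ((2 <= q)%Z -> Derive rho 0 = Derive alpha 0))
    /\
    (alpha 0 = 0 /\ beta 0 = 0 ->
     Rabs (Derive alpha 0) > Rabs (Derive beta 0) ->
       ex_derive rho 0 /\
       Derive rho 0 =
         sign (Derive alpha 0) *
         sqrt (Rabs (Derive alpha 0) ^ 2 - Rabs (Derive beta 0) ^ 2)).
Proof.
  intros p q alpha beta Hpq Hcop Ca Cb Ea b0 rho.
  assert (Ha := proj1 (locally_singleton _ _ Ca)).
  assert (Hb := proj1 (locally_singleton _ _ Cb)).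
  assert (Hres : alpha 0 = 0 ->
            is_derive rho 0 (mean_speed (Derive alpha 0) (Derive beta 0))).
  { intros a0; apply is_derive_rotation_resonant; auto; now apply Derive_correct. }
  split.
  - intros _.
    destruct (Z.eq_dec q 1) as [q1|q1].
    + split; [|lia].
      (* [q = 1] forces [p = 0] *)
      eexists; apply Hres.
      rewrite Ea; replace p with 0%Z by lia; unfold Rdiv; ring.
    + assert (Hp : (0 < p)%Z).
      { destruct (Z.eq_dec p 0) as [p0|p0]; [|lia].
        subst p; apply rel_prime_sym, Zgcd_1_rel_prime in Hcop.
        rewrite Z.gcd_0_r, Z.abs_eq in Hcop; lia. }
      assert (Hd : is_derive rho 0 (Derive alpha 0)).
      { apply is_derive_rotation_nonresonant; auto; [now apply Derive_correct|].
        destruct Hpq as [_ pq].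
        apply IZR_lt in Hp, pq.
        generalize PI_RGT_0; intros pi0.
        rewrite Ea; apply sin_gt_0.
        - apply Rmult_lt_0_compat; [exact pi0|apply Rdiv_lt_0_compat; lra].
        - rewrite <- (Rmult_1_r PI) at 2; apply Rmult_lt_compat_l; [exact pi0|].
          apply Rlt_div_l; lra. }
      split; [eexists; exact Hd|intros _; now apply is_derive_unique].
  - intros [a0 _] _; split; [eexists; exact (Hres a0)|].
    rewrite !pow2_abs; now apply is_derive_unique, Hres.
Qed.
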